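(* Let $\gamma,n$ be odd positive integers and $N$ a positive integer, and let $n$ start an integral loop of length $N$ (for the map $C_\gamma$). Let $\rho$ and $\nu$ be the numbers of zeros and ones in a single period of the characteristic trajectory of $n$, $[n]$ the integral loop vector, $\mathcal{M}_n$ the associated $\nu\times\nu$ matrix, and $(i_j)_{j=0}^{\nu-1}$ the indexing sequence of $n$ (with $i_\nu=N$). Let $s=\gcd(n,C_\gamma^{i_1}(n))$ and let $p$ be a prime factor of $s$. Let $a,d\in\mathbb{Z}_{\ge0}$ be the maximal exponents such that $p^a$ divides every component of $[n]$ and $p^d$ divides every component of $\mathcal{M}_n\overrightarrow{\mathfrak{3}}^{\nu}$. Let $b,c\in\mathbb{Z}_{\ge0}$ be the maximal exponents such that $p^b$ divides $\gamma$ and $p^c$ divides $2^\rho-3^\nu$. Then $$a-b+c-d=0.$$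
   Context: For an odd positive integer $\gamma$, $C_\gamma:\mathbb{Z}_{>0}\to\mathbb{Z}_{>0}$ is $C_\gamma(x)=3x+\gamma$ if $x$ is odd, $C_\gamma(x)=x/2$ if $x$ is even; $C_\gamma^k$ is the $k$-fold iterate ($C_\gamma^0=\mathrm{id}$). $n$ starts an integral loop of length $N$ if $N$ is the least positive integer with $C_\gamma^N(n)=n$. $\chi_\gamma^i(n)\in\{0,1\}$ is the parity of $C_\gamma^i(n)$ ($1$ if odd, $0$ if even); the characteristic trajectory is $B=(\chi_\gamma^i(n))_{i\ge0}$, and a single period consists of the indices $0\le i\le N-1$. For $n$ odd, the indexing sequence $0=i_0<i_1<\cdots<i_{\nu-1}\le N-1$ lists the indices in $[0,N-1]$ with $\chi_\gamma^{i_j}(n)=1$; by convention $i_\nu=N$. For $1\le j\le\nu-1$, $m_j$ is the number of zeros of $B$ strictly between positions $i_{j-1}$ and $i_j$, and $m_\nu$ is the number of zeros at positions after $i_{\nu-1}$ and at most $N-1$. The integral loop vector is $[n]=(C_\gamma^{i_0}(n),\ldots,C_\gamma^{i_{\nu-1}}(n))^T$. The vector $\overrightarrow{\mathfrak{3}}^{\nu}$ is $(3^{\nu-1},3^{\nu-2},\ldots,3,1)^T$. Let $|j|_\nu\in\{0,\ldots,\nu-1\}$ be $j$ modulo $\nu$ and $e_{j,k}$ the $\nu\times\nu$ matrix units. Then $\mathcal{D}_n=\sum_{j=1}^\nu 2^{m_j}e_{j,|j|_\nu+1}$ and $\mathcal{M}_n=\sum_{k=1}^{\nu}\mathcal{D}_n^{k-1}\sum_{j=1}^\nu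 e_{j,k}$ (with $\mathcal{D}_n^0$ the identity). *)

(* Defs.v *)
From HB Require Import structures.
From mathcomp Require Import all_boot all_order all_algebra.

Set Implicit Arguments.
Unset Strict Implicit.
Unset Printing Implicit Defensive.

Import GRing.Theory.

(* Positive integers are modelled in [nat]: for odd [gamma], [Cmap gamma] maps
   positive numbers to positive numbers. *)
Definition Cmap (gamma x : nat) : nat :=
  if odd x then 3 * x + gamma else x./2.

Definition starts_loop (gamma n N : nat) : Prop :=
  [/\ 0 < N, iter N (Cmap gamma) n = n
    & forall k, 0 < k < N -> iter k (Cmap gamma) n <> n].

Definition chi (gamma n i : nat) : nat := odd (iter i (Cmap gamma) n).

Definition nzeros (gamma n N : nat) : nat :=
  count (fun i => chi gamma n i == 0) (iota 0 N).

Definition nones (gamma n N : nat) : nat :=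
  count (fun i => chi gamma n i == 1) (iota 0 N).

(* The default value [N] of [nth] encodes the convention that the entry of
   index [nones gamma n N] is [N]. *)
Definition idx (gamma n N j : nat) : nat :=
  nth N [seq i <- iota 0 N | chi gamma n i == 1] j.

(* [gap gamma n N j] is the number m_j of zeros, with j counted from 1.  For
   [j = nones gamma n N] the upper bound [idx gamma n N j] is [N], so the last
   gap needs no separate case. *)
Definition gap (gamma n N j : nat) : nat :=
  count (fun t => (idx gamma n N j.-1 < t < idx gamma n N j)
                  && (chi gamma n t == 0)) (iota 0 N).

Local Open Scope ring_scope.

Definition loop_vector (gamma n N : nat) : 'cV[int]_(nones gamma n N) :=
  \col_(j < nones gamma n N) (iter (idx gamma n N j) (Cmap gamma) n)%:Z.

Definition three_vector (nu : nat) : 'cV[int]_nu :=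
  \col_(k < nu) 3 ^+ (nu.-1 - k).

(* Matrix indices are counted from 0: row [j] holds 2 ^ m_(j + 1), in column
   [ordS j], the successor of [j] modulo the dimension. *)
Definition D_mx (gamma n N : nat) : 'M[int]_(nones gamma n N) :=
  \sum_(j < nones gamma n N) 2 ^+ gap gamma n N j.+1 *: delta_mx j (ordS j).

Definition M_mx (gamma n N : nat) : 'M[int]_(nones gamma n N) :=
  \sum_(k < nones gamma n N)
    D_mx gamma n N ^+ k *m \sum_(j < nones gamma n N) delta_mx j k.

Definition dvd_components (m : nat) (v : int) (x : 'cV[int]_m) : Prop :=
  forall j : 'I_m, (v %| x j ord0)%Z.

Definition max_exponent (P : nat -> Prop) (e : nat) : Prop :=
  P e /\ forall f : nat, P f -> (f <= e)%N.

(* Main.v *)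
Require Import Defs.
From HB Require Import structures.
From mathcomp Require Import all_boot all_order all_algebra.
From mathcomp Require Import zify.
Import GRing.Theory.
Local Open Scope ring_scope.

(** The components of the loop vector x satisfy x_{j+1} = (3 x_j + gamma) / 2^m
    with m the gap after the j-th one, cyclically because the orbit closes up.
    In matrix form (D - 3) x = gamma 1, where 1 is the all-ones vector
    ([D_mx_loop_vector]).  Multiplying by the sum S of the 3^(nu-1-k) D^k over
    k < nu turns the left side into (D^nu - 3^nu) x.  As D is a weighted cyclic
    shift, D^nu is multiplication by the product of all its weights, that is by
    2^rho, the gaps containing all the zeros of a period
    ([D_mx_full_turn]); and S 1 is exactly M applied to the vector of powers of
    3 ([M_mx_three_vector]).  Hence, componentwise,

      gamma (M 3vec) = (2^rho - 3^nu) [n]      ([loop_equation]).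

    The exponent of p in a scalar multiple of a vector is the sum of the
    exponents in the scalar and in the vector, so b + d = c + a.  The two
    inequalities both come from [exponent_add_le]. *)

(** * Weighted cyclic shifts *)

Definition cyclic_shift {R : comNzRingType} {m : nat} (w : 'I_m -> R) : 'M[R]_m :=
  \sum_(j < m) w j *: delta_mx j (ordS j).

Lemma cyclic_shiftE (R : comNzRingType) (m : nat) (w : 'I_m -> R) (x : 'cV_m)
    (j : 'I_m) :
  (cyclic_shift w *m x) j ord0 = w j * x (ordS j) ord0.
Proof.
rewrite mulmx_suml summxE (bigD1 j) //= big1 => [|i ij].
  rewrite addr0 -scalemxAl mxE; congr (_ * _).
  rewrite mxE (bigD1 (ordS j)) //= big1 => [|k kj].
    by rewrite mxE !eqxx mul1r addr0.
  by rewrite mxE eqxx (negPf kj) mul0r.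
rewrite -scalemxAl mxE mxE big1 ?mulr0 // => k _.
by rewrite mxE eq_sym (negPf ij) mul0r.
Qed.

Lemma cyclic_shift_expE (R : comNzRingType) (m : nat) (w : 'I_m -> R) (x : 'cV_m)
    (k : nat) (j : 'I_m) :
  (cyclic_shift w ^+ k *m x) j ord0 =
  (\prod_(i < k) w (iter i (@ordS m) j)) * x (iter k (@ordS m) j) ord0.
Proof.
elim: k j => [|k IHk] j; first by rewrite big_ord0 mul1r expr0 mul1mx.
rewrite exprS -mulmxA cyclic_shiftE IHk big_ord_recl mulrA -iterSr.
congr (_ * _ * _); apply: eq_bigr => i _.
by rewrite [in RHS]lift0 iterSr.
Qed.

Lemma val_iter_ordS (m k : nat) (j : 'I_m) :
  iter k (@ordS m) j = ((j + k) %% m)%N :> nat.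
Proof.
elim: k => [|k IHk] /=; first by rewrite addn0 modn_small.
by rewrite IHk addnS -addn1 modnDml addn1.
Qed.

(** A full turn visits every index exactly once and comes back to its start, so
    it multiplies by all the weights. *)
Lemma cyclic_shift_full_turn (R : comNzRingType) (m : nat) (w : 'I_m -> R)
    (x : 'cV_m) :
  cyclic_shift w ^+ m *m x = (\prod_j w j) *: x.
Proof.
apply/colP => j; rewrite cyclic_shift_expE mxE.
have turn_inj : injective (fun i : 'I_m => iter i (@ordS m) j).
  move=> i i' /(congr1 val); rewrite /= !val_iter_ordS => /eqP.
  by rewrite eqn_modDl !modn_small // => /eqP /val_inj.
rewrite [in RHS](reindex_inj turn_inj) /=; congr (_ * x _ _).
by apply: val_inj; rewrite /= val_iter_ordS modnDr modn_small.
Qed.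

(** * Positions of the ones in a period *)

Lemma count_between (i k M : nat) :
  (i < k <= M)%N -> count (fun t => i < t < k)%N (iota 0 M) = (k - i.+1)%N.
Proof.
move=> /andP[lt_ik le_kM].
have -> : iota 0 M = iota 0 i.+1 ++ iota i.+1 (k - i.+1) ++ iota k (M - k).
  by rewrite catA -iotaD subnKC // -{2}(add0n k) -iotaD subnKC.
rewrite !count_cat -[RHS](size_iota i.+1).
rewrite (@eq_in_count _ _ pred0 (iota 0 i.+1)); last first.
  by move=> t; rewrite mem_iota /=; lia.
rewrite (@eq_in_count _ _ predT (iota i.+1 _)); last first.
  by move=> t; rewrite mem_iota /=; lia.
rewrite (@eq_in_count _ _ pred0 (iota k _)); last first.
  by move=> t; rewrite mem_iota /=; lia.
by rewrite !count_pred0 count_predT addn0.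
Qed.

Section Period.

Variables gamma n N : nat.

Local Notation nu := (nones gamma n N).
Local Notation idx := (idx gamma n N).
Local Notation orbit t := (iter t (Cmap gamma) n).

Let ones := [seq i <- iota 0 N | chi gamma n i == 1%N].

Let size_ones : size ones = nu.
Proof. by rewrite size_filter. Qed.

Let mem_ones t : (t \in ones) = (t < N)%N && odd (orbit t).
Proof. by rewrite mem_filter mem_iota /= add0n /chi eqb1 andbC. Qed.

Lemma idx_mem j : (j < nu)%N -> (idx j < N)%N && odd (orbit (idx j)).
Proof. by move=> lt_j; rewrite -mem_ones mem_nth ?size_ones. Qed.

Lemma idx_last : idx nu = N.
Proof. by rewrite /Defs.idx nth_default ?size_ones. Qed.

Lemma idx_lt j : (j < nu)%N -> (idx j < idx j.+1)%N.
Proof.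
move=> lt_j; have [lt_j1|] := ltnP j.+1 nu.
  have srt : sorted ltn ones.
    by apply: sorted_filter; [exact: ltn_trans | exact: iota_ltn_sorted].
  by apply: (sorted_ltn_nth ltn_trans N srt); rewrite ?inE ?size_ones.
move=> le_j1; have -> : j.+1 = nu by lia.
by rewrite idx_last; case/andP: (idx_mem _ lt_j).
Qed.

Lemma idx_le_period j : (idx j <= N)%N.
Proof.
have [/idx_mem/andP[/ltnW //]|le_j] := ltnP j nu.
by rewrite /Defs.idx nth_default ?size_ones.
Qed.

(** A one strictly between two consecutive entries of the increasing list of
    ones would have a rank strictly between two consecutive integers. *)
Lemma even_between_idx j t :
  (j < nu)%N -> (idx j < t < idx j.+1)%N -> ~~ odd (orbit t).
Proof.
move=> lt_j /andP[lt_jt lt_tj]; apply/negP => odd_t.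
have t_one : t \in ones.
  by rewrite mem_ones odd_t (leq_trans lt_tj (idx_le_period _)).
have lt_k : (index t ones < nu)%N by rewrite -size_ones index_mem.
have tE : t = idx (index t ones) by rewrite /Defs.idx nth_index.
have srt : sorted leq ones.
  by apply: sorted_filter; [exact: leq_trans | exact: iota_sorted].
have mono i k : (i <= k)%N -> (k <= nu)%N -> (idx i <= idx k)%N.
  move=> le_ik; rewrite leq_eqVlt => /orP[/eqP->|lt_knu].
    by rewrite idx_last idx_le_period.
  apply: (sorted_leq_nth leq_trans leqnn N srt) => //; rewrite inE size_ones //.
  exact: leq_ltn_trans lt_knu.
have [le_kj|lt_jk] := leqP (index t ones) j.
  by have := mono _ _ le_kj (ltnW lt_j); rewrite -tE leqNgt lt_jt.
by have := mono _ _ lt_jk (ltnW lt_k); rewrite -tE leqNgt lt_tj.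
Qed.

(** The positions between two consecutive ones all carry zeros, so the parity
    test in the definition of the gap filters nothing out. *)
Lemma gapE j : (j < nu)%N -> gap gamma n N j.+1 = (idx j.+1 - (idx j).+1)%N.
Proof.
move=> lt_j; rewrite -(@count_between _ _ N) ?idx_lt ?idx_le_period //.
apply: eq_in_count => t _ /=.
case between : (_ < _ < _)%N => //=.
by rewrite /chi eqb0 (even_between_idx _ _ lt_j between).
Qed.

(** The odd step at the j-th one is followed by halvings only, one for each zero
    of the gap, so clearing the powers of 2 recovers the value 3 x + gamma. *)
Lemma orbit_gap j : (j < nu)%N ->
  (2 ^ gap gamma n N j.+1 * orbit (idx j.+1) = 3 * orbit (idx j) + gamma)%N.
Proof.
move=> lt_j; have lt_idx := idx_lt _ lt_j.
have halve k : ((idx j).+1 + k <= idx j.+1)%N ->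
    (2 ^ k * orbit ((idx j).+1 + k) = 3 * orbit (idx j) + gamma)%N.
  elim: k => [|k IHk] le_k.
    case/andP: (idx_mem _ lt_j) => _ odd_j.
    by rewrite mul1n addn0 iterS {1}/Cmap odd_j.
  rewrite addnS in le_k *.
  rewrite -IHk; last exact: ltnW.
  have even_k : ~~ odd (orbit ((idx j).+1 + k)).
    by apply: (even_between_idx _ _ lt_j); lia.
  rewrite iterS {1}/Cmap (negPf even_k) expnSr -mulnA mul2n.
  by rewrite even_halfK.
rewrite gapE // -[X in orbit X](subnKC lt_idx) halve //.
by rewrite subnKC.
Qed.

Hypothesis n_odd : odd n.
Hypothesis N_gt0 : (0 < N)%N.

Lemma idx0 : idx 0 = 0%N.
Proof.
rewrite /Defs.idx; case: N N_gt0 => // N' _.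
by rewrite /= /chi /= n_odd.
Qed.

Lemma nzeros_add_nones : (nzeros gamma n N + nu = N)%N.
Proof.
rewrite /nzeros /nones -[RHS](size_iota 0) -(count_predC (fun i => chi gamma n i == 0%N)).
congr addn; apply: eq_count => t /=.
by rewrite /chi; case: odd.
Qed.

(** The gap lengths telescope, since the first one sits at position 0 and the
    last gap ends at the period. *)
Lemma sum_gap : (\sum_(j < nu) gap gamma n N j.+1 = nzeros gamma n N)%N.
Proof.
have telescope k : (k <= nu)%N ->
    (\sum_(j < k) gap gamma n N j.+1 + k = idx k)%N.
  elim: k => [|k IHk] lt_k; first by rewrite big_ord0 idx0.
  rewrite big_ord_recr /= gapE //.
  move: (IHk (ltnW lt_k)) (idx_lt _ lt_k).
  by move: (\sum_(i < k) _)%N => S; lia.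
by apply: (@addIn nu); rewrite telescope // nzeros_add_nones idx_last.
Qed.

(** * The loop equation *)

Hypothesis loop : orbit N = n.

Lemma D_mx_loop_vector :
  D_mx gamma n N *m loop_vector gamma n N =
  3 *: loop_vector gamma n N + const_mx gamma%:Z.
Proof.
apply/colP => j; rewrite [LHS]cyclic_shiftE !mxE.
(* The successor of the last index is 0, while the gap ends at [N]: both give
   the value [n] because the orbit has closed up. *)
have -> : orbit (idx (ordS j)) = orbit (idx j.+1).
  rewrite /=; have [lt_j|ge_j] := ltnP j.+1 nu; first by rewrite modn_small.
  have -> : j.+1 = nu by have := ltn_ord j; lia.
  by rewrite modnn idx0 idx_last loop.
move: (congr1 Posz (orbit_gap _ (ltn_ord j))).
by rewrite PoszD !PoszM -[Posz (2 ^ _)]natz natrX => ->.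
Qed.

Lemma D_mx_full_turn (x : 'cV[int]_nu) :
  D_mx gamma n N ^+ nu *m x = 2 ^+ nzeros gamma n N *: x.
Proof.
by rewrite cyclic_shift_full_turn -sum_gap expr_sum.
Qed.

(** The k-th matrix of units sends any vector v to v_k times the all-ones
    vector, so the powers of 3 become scalar coefficients of the powers of D. *)
Lemma M_mx_three_vector :
  M_mx gamma n N *m three_vector nu =
  (\sum_(k < nu) 3 ^+ (nu.-1 - k) *: D_mx gamma n N ^+ k) *m const_mx 1.
Proof.
rewrite !mulmx_suml; apply: eq_bigr => k _.
rewrite -mulmxA -scalemxAl scalemxAr; congr (_ *m _).
apply/colP => j; rewrite mulmx_suml summxE (bigD1 j) //= big1 => [|i ij].
  rewrite !mxE (bigD1 k) //= big1 => [|l lk].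
    by rewrite !mxE !eqxx mul1r mulr1 !addr0.
  by rewrite !mxE eqxx (negPf lk) mul0r.
rewrite mxE big1 // => l _.
by rewrite !mxE eq_sym (negPf ij) mul0r.
Qed.

(** The factorization of D^nu - 3^nu by D - 3, applied to the loop vector. *)
Lemma loop_equation :
  gamma%:Z *: (M_mx gamma n N *m three_vector nu) =
  (2 ^+ nzeros gamma n N - 3 ^+ nu) *: loop_vector gamma n N.
Proof.
rewrite M_mx_three_vector scalemxAr scalemx_const mulr1.
have -> : const_mx gamma%:Z =
    (D_mx gamma n N - 3%:M) *m loop_vector gamma n N.
  by rewrite mulmxBl mul_scalar_mx D_mx_loop_vector addrC addKr.
rewrite mulmxA scalerBl -D_mx_full_turn -mul_scalar_mx -mulmxBl.
congr (_ *m _).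
set D := D_mx gamma n N.
have comm3 : GRing.comm D 3%:M by exact: comm_mx_scalar.
have -> : (3 ^+ nu)%:M = 3%:M ^+ nu :> 'M[int]_nu by rewrite rmorphXn.
(* The telescoping identity puts the factor on the left of the sum, with 3 and D
   in the order of [3 - D]; what remains is that [D - 3] commutes with S. *)
rewrite -[RHS]opprB (subrXX_comm _ (commr_sym comm3)).
rewrite -mulNr opprB.
set S := \sum_(k < nu) _.
have -> : \sum_(i < nu) 3%:M ^+ (nu.-1 - i) * D ^+ i = S.
  by apply: eq_bigr => k _; rewrite -rmorphXn -mul_scalar_mx.
suff : GRing.comm (D - 3%:M) S by move=> ->.
apply: commr_sum => k _.
rewrite -mul_scalar_mx; apply: commrM; first exact: comm_mx_scalar.
apply: commrX; apply: commr_sym; apply: commrB => //.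
Qed.

End Period.

(** * Exponents of a prime in scalar multiples of vectors *)

(** Dividing L by its exact power of p leaves a cofactor prime to p, which
    cannot absorb any of the p^(c + a) dividing K x = L y; what p^b does not
    account for divides y. *)
Lemma exponent_add_le {p m : nat} {K L : int} {x y : 'cV[int]_m} {a b c d : nat} :
    prime p -> K *: x = L *: y ->
    (p%:Z ^+ c %| K)%Z -> dvd_components (p%:Z ^+ a) x ->
    max_exponent (fun e => (p%:Z ^+ e %| L)%Z) b ->
    max_exponent (fun e => dvd_components (p%:Z ^+ e) y) d ->
  (c + a <= b + d)%N.
Proof.
move=> p_pr KxLy p_K p_x [p_L max_b] [_ max_d].
have [|le_b] := leqP (c + a) b; first by move/leq_trans; apply; rewrite leq_addr.
rewrite -leq_subLR; apply: max_d => j.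
have pb_neq0 : p%:Z ^+ b != 0 by rewrite expf_neq0 // eqz_nat -lt0n prime_gt0.
case/dvdzP: p_L => L' LE.
have p_L' : coprimez (p%:Z ^+ (c + a - b)) L'.
  apply: coprimezXl; rewrite coprimezE prime_coprime //; apply/negP => pL'.
  suff /max_b : (p%:Z ^+ b.+1 %| L)%Z by rewrite ltnn.
  by rewrite LE exprS; apply: dvdz_mul.
rewrite -(Gauss_dvdzr _ p_L').
rewrite -(dvdz_mul2l pb_neq0).
rewrite -exprD subnKC; last exact: ltnW.
rewrite mulrA (mulrC _ L') -LE exprD.
have := congr1 (fun z : 'cV_m => z j ord0) KxLy; rewrite !mxE => <-.
exact: dvdz_mul.
Qed.

Theorem proposition1p5p3 (gamma n N : nat) (hgamma : odd gamma) (hn : odd n)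
    (hloop : starts_loop gamma n N)
    (p : nat) (hp : prime p)
    (hps : (p %| gcdn n (iter (idx gamma n N 1) (Cmap gamma) n))%N)
    (a b c d : nat)
    (ha : max_exponent
            (fun e : nat => dvd_components (p%:Z ^+ e) (loop_vector gamma n N)) a)
    (hd : max_exponent
            (fun e : nat => dvd_components (p%:Z ^+ e)
               (M_mx gamma n N *m three_vector (nones gamma n N))) d)
    (hb : max_exponent (fun e : nat => (p ^ e %| gamma)%N) b)
    (hc : max_exponent
            (fun e : nat =>
               ((p%:Z ^+ e)%R %| (2 ^+ nzeros gamma n N - 3 ^+ nones gamma n N)%R)%Z) c) :
  a%:Z - b%:Z + c%:Z - d%:Z = 0.
Proof.
case: hloop => N_gt0 loop _.
have eqn := loop_equation gamma n N hn N_gt0 loop.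
have hb' : max_exponent (fun e => (p%:Z ^+ e %| gamma%:Z)%Z) b.
  case: hb => p_gamma max_b; split=> [|e].
    by rewrite /dvdz /= abszX.
  by rewrite /dvdz /= abszX => /max_b.
have le1 := exponent_add_le hp eqn hb'.1 hd.1 hc ha.
have le2 := exponent_add_le hp (esym eqn) hc.1 ha.1 hb' hd.
lia.
Qed.
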